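(* Let $X_1,\ldots,X_n$ be $\{0,1\}$-valued random variables with means $\mathbb{E}[X_i]=x_i$ satisfying 1-negative association. Let $f:\{0,1\}^n\to\mathbb{R}_{\ge0}$ be a non-negative monotone (non-decreasing) submodular function whose marginal values $f(S\cup\{i\})-f(S)$ all lie in $[0,1]$, and let $F$ be its multilinear extension. Let $\mu_0=F(x_1,\ldots,x_n)$. Then for every $\delta\in(0,1)$, $$\Pr[f(X_1,\ldots,X_n)\le(1-\delta)\mu_0]\le\exp(-\mu_0\delta^2/2).$$
   Context: 1-negative association: for every index $i$, every monotone function $g$ of $X_i$ alone and every monotone function $h$ of $(X_j)_{j\ne i}$, monotone in the same direction (both non-decreasing or both non-increasing), $\mathbb{E}[hg]\le\mathbb{E}[h]\mathbb{E}[g]$. Identifying $\{0,1\}^n$ with subsets of $[n]$, $f$ is submodular if $f(S\cup\{i\})-f(S)\ge f(T\cup\{i\})-f(T)$ whenever $S\subseteq T$, $i\notin T$. The multilinear extension is $F(x)=\sum_{S\subseteq[n]}f(S)\prod_{i\in S}x_i\prod_{i\notin S}(1-x_i)$ for $x\in[0,1]^n$. *)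

(* Defs.v *)
From HB Require Import structures.
From mathcomp Require Import all_boot all_order all_algebra.
From mathcomp Require Import all_classical all_reals all_analysis.

Set Implicit Arguments.
Unset Strict Implicit.
Unset Printing Implicit Defensive.

Import Order.TTheory GRing.Theory Num.Theory.

Local Open Scope ring_scope.

(* Points of {0,1}^I are compared coordinatewise; on [bool], [a ==> b] is the
   order 0 <= 1. *)
Definition cube_le (I : finType) (y z : {ffun I -> bool}) : Prop :=
  forall j, y j ==> z j.

Definition cube_nondecreasing (R : realType) (I : finType)
    (h : {ffun I -> bool} -> R) : Prop :=
  forall y z, cube_le y z -> h y <= h z.

Definition cube_nonincreasing (R : realType) (I : finType)
    (h : {ffun I -> bool} -> R) : Prop :=
  forall y z, cube_le y z -> h z <= h y.

Definition bool_nondecreasing (R : realType) (g : bool -> R) : Prop :=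
  forall a b : bool, a ==> b -> g a <= g b.

Definition bool_nonincreasing (R : realType) (g : bool -> R) : Prop :=
  forall a b : bool, a ==> b -> g b <= g a.

Definition others (n : nat) (i : 'I_n) (T : Type) (X : 'I_n -> T -> bool)
    (w : T) : {ffun {j : 'I_n | j != i} -> bool} :=
  [ffun j => X (val j) w].

Definition one_negatively_associated (d : measure_display)
    (T : measurableType d) (R : realType) (P : probability T R) (n : nat)
    (X : 'I_n -> {RV P >-> bool}) : Prop :=
  forall (i : 'I_n) (g : bool -> R)
         (h : {ffun {j : 'I_n | j != i} -> bool} -> R),
    (bool_nondecreasing g /\ cube_nondecreasing h) \/
    (bool_nonincreasing g /\ cube_nonincreasing h) ->
    ('E_P[fun w => (h (others i X w) * g (X i w))%R]
      <= 'E_P[fun w => h (others i X w)] * 'E_P[fun w => g (X i w)])%E.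

Definition set_nondecreasing (R : realType) (n : nat)
    (f : {set 'I_n} -> R) : Prop :=
  forall S T : {set 'I_n}, S \subset T -> f S <= f T.

Definition submodular (R : realType) (n : nat) (f : {set 'I_n} -> R) : Prop :=
  forall (S T : {set 'I_n}) (i : 'I_n), S \subset T -> i \notin T ->
    f (i |: T) - f T <= f (i |: S) - f S.

Definition multilinear_extension (R : realType) (n : nat)
    (f : {set 'I_n} -> R) (x : 'I_n -> R) : R :=
  \sum_(S : {set 'I_n})
    f S * (\prod_(i in S) x i) * (\prod_(i | i \notin S) (1 - x i)).

(* The subset of indices identified with the point (X_1 w, ..., X_n w). *)
Definition random_set (n : nat) (T : Type) (X : 'I_n -> T -> bool) (w : T) :
    {set 'I_n} :=
  [set i | X i w]%SET.

(* Main.v *)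
Require Import Defs.
From HB Require Import structures.
From mathcomp Require Import all_boot all_order all_algebra.
From mathcomp Require Import all_classical all_reals all_analysis.
From mathcomp Require Import ring lra.

(* For lam >= 0 the function u(S) = exp(- lam f(S)) is supermodular. 1-negative
   association says that replacing one coordinate of a supermodular function
   by its independent average does not decrease the expectation; averaging
   preserves supermodularity, so doing this coordinate by coordinate yields
   E[u(X)] <= U(x), with U the multilinear extension of u.

   For independent coordinates, revealing them one at a time and using Harris'
   inequality with the chord bound exp(- lam t) <= 1 - (1 - exp(- lam)) t on
   [0, 1] gives U(x) <= exp(- (1 - exp(- lam)) mu0). Markov's inequality with
   lam = delta and exp(- delta) <= 1 - delta + delta^2 / 2 concludes. *)

Set Implicit Arguments.
Unset Strict Implicit.
Unset Printing Implicit Defensive.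

Import Order.TTheory GRing.Theory Num.Theory.

Local Open Scope ring_scope.

(** * Scalar exponential inequalities *)

(** Convexity through tangents: the tangent to [expR] at [z] lies below [expR] at [0] and at
    [- lam]. Weighting these two bounds by [1 - t] and [t] cancels the slope terms, since [z] is the
    weighted mean of the two points. *)
Lemma expR_chord (R : realType) (lam t : R) : 0 <= t <= 1 ->
  expR (- lam * t) <= 1 - (1 - expR (- lam)) * t.
Proof.
move=> /andP[t0 t1]; set z := - lam * t.
have ez : 0 < expR z by exact: expR_gt0.
have H y : expR z * (1 + (y - z)) <= expR y.
  rewrite -[in leRHS](subrKC z y) expRD.
  by rewrite ler_pM2l// expR_ge1Dx.
have H0 := H 0; have H1 := H (- lam); rewrite expR0 in H0.
have K0 : (1 - t) * (expR z * (1 + (0 - z))) <= (1 - t) * 1.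
  by rewrite ler_wpM2l// subr_ge0.
have K1 : t * (expR z * (1 + (- lam - z))) <= t * expR (- lam).
  by rewrite ler_wpM2l.
have : expR z =
    (1 - t) * (expR z * (1 + (0 - z))) + t * (expR z * (1 + (- lam - z))).
  by rewrite /z; ring.
lra.
Qed.

Lemma expR_ge_taylor2 (R : realType) (y : R) :
  0 <= y -> 1 + y + y ^+ 2 / 2 <= expR y.
Proof.
move=> y0; have -> : 1 + y + y ^+ 2 / 2 = series (exp_coeff y) 3.
  rewrite /series /= !big_nat_recr//= big_geq// /exp_coeff /= add0r.
  by rewrite expr0 expr1 fact0 !divr1.
apply: nondecreasing_cvgn_le; last exact: is_cvg_series_exp_coeff.
apply: nondecreasing_series => k _ _; exact: exp_coeff_ge0.
Qed.

(** After multiplication by [expR y], the Taylor lower bound reduces the claim to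
    [1 <= 1 + y ^+ 4 / 4], the product of the two quadratics. *)
Lemma expRN_le_taylor2 (R : realType) (y : R) :
  0 <= y -> expR (- y) <= 1 - y + y ^+ 2 / 2.
Proof.
move=> y0; have := expR_ge_taylor2 y0 => H.
have E : expR (- y) * expR y = 1 by rewrite -expRD addNr expR0.
have q0 : 0 <= 1 - y + y ^+ 2 / 2.
  have -> : 1 - y + y ^+ 2 / 2 = ((1 - y) ^+ 2 + 1) / 2 by field.
  by rewrite divr_ge0// addr_ge0// sqr_ge0.
rewrite -(ler_pM2r (expR_gt0 y)) E.
apply: (le_trans _ (ler_wpM2l q0 H)).
have -> : (1 - y + y ^+ 2 / 2) * (1 + y + y ^+ 2 / 2) =
    1 + (y ^+ 2 / 2) ^+ 2 by field.
by rewrite lerDl sqr_ge0.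
Qed.

(** * Multilinear extensions by coordinatewise averaging *)

Section Averaging.
Variables (R : realType) (n : nat) (x : 'I_n -> R).
Hypothesis x01 : forall i, 0 <= x i <= 1.
Implicit Types (u v : {set 'I_n} -> R) (S : {set 'I_n}) (i j : 'I_n).

Local Notation M u := (multilinear_extension u x).

(** The mean of [u] when membership of [i] is resampled with probability [x i] and the rest of [S]
    is kept. *)
Definition avg i u S : R := (1 - x i) * u (S :\ i) + x i * u (i |: S).

Definition avg_seq (s : seq 'I_n) u : {set 'I_n} -> R := foldr avg u s.

Definition set_weight S : R := \prod_i (if i \in S then x i else 1 - x i).

Lemma multilinear_extensionE u : M u = \sum_S u S * set_weight S.
Proof.
apply: eq_bigr => S _; rewrite -mulrA; congr (_ * _).
rewrite /set_weight [RHS](bigID (mem S)) /=; congr (_ * _).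
  by apply: eq_bigr => i ->.
by apply: eq_bigr => i /negbTE ->.
Qed.

Lemma set_weight_ge0 S : 0 <= set_weight S.
Proof.
by apply: prodr_ge0 => i _; have := x01 i; case: ifP => _; lra.
Qed.

Lemma multilinear_extension_cst (c : R) : M (fun=> c) = c.
Proof.
rewrite multilinear_extensionE -mulr_sumr.
rewrite -(bigA_distr 1 +%R x (fun i => 1 - x i)).
by rewrite big1 ?mulr1// => i _ /=; rewrite subrKC.
Qed.

Lemma multilinear_extension_le u v : (forall S, u S <= v S) -> M u <= M v.
Proof.
move=> uv; rewrite !multilinear_extensionE; apply: ler_sum => S _.
by rewrite ler_wpM2r ?set_weight_ge0.
Qed.

Lemma multilinear_extensionD u v : M (fun S => u S + v S) = M u + M v.
Proof.
rewrite !multilinear_extensionE -big_split/=.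
by apply: eq_bigr => S _; rewrite mulrDl.
Qed.

Lemma multilinear_extensionZ (c : R) u : M (fun S => c * u S) = c * M u.
Proof.
rewrite !multilinear_extensionE mulr_sumr.
by apply: eq_bigr => S _; rewrite mulrA.
Qed.

Lemma sum_set_split i (G : {set 'I_n} -> R) :
  \sum_S G S = \sum_(S : {set 'I_n} | i \notin S) (G S + G (i |: S)).
Proof.
rewrite (bigID (fun S : {set 'I_n} => i \notin S)) /= big_split /=.
congr (_ + _).
rewrite (reindex_onto (fun S => i |: S) (fun S => S :\ i)) /=; last first.
  by move=> S; rewrite negbK => iS; rewrite finset.setD1K.
apply: eq_bigl => S; rewrite !inE eqxx /=.
by apply/eqP/idP => [<-|/finset.setU1K//]; rewrite !inE eqxx.
Qed.

(** Resampling one coordinate preserves the product law: the weights of [S] and [i |: S] are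
    [1 - x i] and [x i] times a common factor [r]. *)
Lemma multilinear_extension_avg i u : M (avg i u) = M u.
Proof.
rewrite !multilinear_extensionE !(sum_set_split i); apply: eq_bigr => S iS.
pose r := \prod_(j | j != i) (if j \in S then x j else 1 - x j).
have -> : set_weight S = (1 - x i) * r.
  by rewrite /set_weight (bigD1 i)//= (negbTE iS).
have -> : set_weight (i |: S) = x i * r.
  rewrite /set_weight (bigD1 i)//= !inE eqxx /=; congr (_ * _).
  by apply: eq_bigr => j /negbTE ji; rewrite !inE ji.
have iSD : S :\ i = S.
  by apply/finset.setDidPl; rewrite disjoint_sym disjoints1.
rewrite /avg iSD finset.setU1K// finset.setUA finset.setUid; ring.
Qed.

(** Once a coordinate has been averaged out, the result no longer depends on it. *)
Lemma avg_seq_agree s u S S' :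
  (forall j, j \notin s -> (j \in S) = (j \in S')) ->
  avg_seq s u S = avg_seq s u S'.
Proof.
elim: s S S' => [|i s IH] S S' SS' /=.
  by congr u; apply/setP => j; exact: SS'.
have E j : j \notin s -> j != i -> (j \in S) = (j \in S').
  by move=> js ji; apply: SS'; rewrite inE negb_or ji js.
rewrite /avg (IH (S :\ i) (S' :\ i)) ?(IH (i |: S) (i |: S'))// => j js;
  by rewrite !inE; have [//|/(E _ js)->] := eqVneq j i.
Qed.

(** Averaging every coordinate leaves a constant function, and no averaging step changes [M]. *)
Lemma multilinear_extension_avg_seq u S : M u = avg_seq (enum 'I_n) u S.
Proof.
have -> : M u = M (avg_seq (enum 'I_n) u).
  by elim: (enum _) => //= i s ->; rewrite multilinear_extension_avg.
rewrite -[RHS](multilinear_extension_cst); congr multilinear_extension.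
by apply/funext => S'; apply: avg_seq_agree => j; rewrite mem_enum inE.
Qed.

Lemma avg_le i u v S : (forall S, u S <= v S) -> avg i u S <= avg i v S.
Proof.
move=> uv; have /andP[? ?] := x01 i.
by apply: lerD; apply: ler_wpM2l => //; lra.
Qed.

Lemma avg_nondecreasing i u :
  set_nondecreasing u -> set_nondecreasing (avg i u).
Proof.
move=> hu S S' SS'; have /andP[? ?] := x01 i.
apply: lerD; apply: ler_wpM2l; rewrite ?subr_ge0//; apply: hu.
  exact: finset.setSD.
exact: finset.setUS.
Qed.

Lemma avgN i u S : avg i (fun S => - u S) S = - avg i u S.
Proof. by rewrite /avg; ring. Qed.

(** Averaging keeps both monotonicities, so the induction reduces to Chebyshev's inequality on a
    two-point space, where the gap is [t * (1 - t) * ((a - b) * (e - c))]. *)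
Lemma avg_seq_harris s u v :
  set_nondecreasing (fun S => - u S) -> set_nondecreasing v ->
  [/\ set_nondecreasing (fun S => - avg_seq s u S),
      set_nondecreasing (avg_seq s v)
    & forall S, avg_seq s (fun S => u S * v S) S <=
        avg_seq s u S * avg_seq s v S].
Proof.
move=> hu hv; elim: s => [|i s [IHu IHv IH]] /=; first by split.
split.
- by move=> A B AB; rewrite -!avgN; exact: avg_nondecreasing.
- exact: avg_nondecreasing.
- move=> A; apply: (le_trans (avg_le i A IH)).
  have sAB : A :\ i \subset i |: A.
    by rewrite (fintype.subset_trans (finset.subD1set _ _))// finset.subsetUr.
  have := IHu _ _ sAB; have := IHv _ _ sAB; rewrite lerN2 /avg.
  move: (avg_seq s u (A :\ i)) (avg_seq s u (i |: A)).
  move: (avg_seq s v (A :\ i)) (avg_seq s v (i |: A)) => c e a b ce ba.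
  have := x01 i; move: (x i) => t /andP[t0 t1].
  rewrite -subr_ge0.
  have -> : ((1 - t) * a + t * b) * ((1 - t) * c + t * e) -
     ((1 - t) * (a * c) + t * (b * e)) =
     t * (1 - t) * ((a - b) * (e - c)) by ring.
  by rewrite !mulr_ge0 ?subr_ge0.
Qed.

Lemma multilinear_extension_harris u v :
  set_nondecreasing (fun S => - u S) -> set_nondecreasing v ->
  M (fun S => u S * v S) <= M u * M v.
Proof.
move=> hu hv; rewrite !(multilinear_extension_avg_seq _ finset.set0).
by have [_ _] := avg_seq_harris (enum 'I_n) hu hv; apply.
Qed.

(** * Exponential moments for independent coordinates *)

Lemma avg_restrict i (A : {set 'I_n}) (G : {set 'I_n} -> R) : i \notin A ->
  avg i (fun S => G (S :&: (i |: A))) =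
    (fun S => (1 - x i) * G (S :&: A) + x i * G (i |: (S :&: A))).
Proof.
move=> iA; apply/funext => S; rewrite /avg; congr (_ * G _ + _ * G _).
  apply/setP => j; rewrite !inE; have [->|//] := eqVneq j i.
  by rewrite (negbTE iA) andbF.
by apply/setP => j; rewrite !inE; case: (j == i).
Qed.

(* Adding one coordinate i to A multiplies e^(- lam f(S :&: A)) by a factor of
   mean at most 1 - a x_i D(S), where the marginal D is nonincreasing in S by
   submodularity; Harris' inequality then separates the two factors. *)
Lemma multilinear_extension_mgf (f : {set 'I_n} -> R) (lam : R) :
  0 <= f finset.set0 -> set_nondecreasing f -> submodular f ->
  (forall S i, f (i |: S) - f S <= 1) -> 0 <= lam ->
  M (fun S => expR (- lam * f S)) <= expR (- (1 - expR (- lam)) * M f).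
Proof.
move=> f0 fmono fsub fmarg lam0; set a := 1 - expR (- lam).
have a0 : 0 <= a by rewrite subr_ge0 -[leRHS]expR0 ler_expR oppr_le0.
(* Induction on the set of revealed coordinates: only the part of [S] inside it counts. *)
suff H (s : seq 'I_n) : M (fun S => expR (- lam * f (S :&: [set j in s]%SET)))
    <= expR (- a * M (fun S => f (S :&: [set j in s]%SET))).
  have := H (enum 'I_n).
  have -> : [set j in enum 'I_n]%SET = finset.setT.
    by apply/setP => j; rewrite !inE mem_enum.
  have -> : (fun S => f (S :&: finset.setT)) = f.
    by apply/funext => S; rewrite finset.setIT.
  have -> // : (fun S => expR (- lam * f (S :&: finset.setT))) =
      (fun S => expR (- lam * f S)).
  by apply/funext => S; rewrite finset.setIT.
elim: s => [|i s IH].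
  have -> : [set j in [::]]%SET = finset.set0 :> {set 'I_n}.
    by apply/setP => j; rewrite !inE.
  have -> : (fun S => f (S :&: finset.set0)) = (fun=> f finset.set0).
    by apply/funext => S; rewrite finset.setI0.
  have -> : (fun S => expR (- lam * f (S :&: finset.set0))) =
      (fun=> expR (- lam * f finset.set0)).
    by apply/funext => S; rewrite finset.setI0.
  (* With nothing revealed, [0 <= f finset.set0] and [a <= lam] suffice. *)
  rewrite !multilinear_extension_cst ler_expR ler_wpM2r// lerN2.
  by have := expR_ge1Dx (- lam); rewrite /a; lra.
rewrite finset.set_cons; move: IH; set A := [set j in s]%SET => IH.
have [iA|iA] := boolP (i \in A).
  suff -> : i |: A = A by [].
  by apply/finset.setUidPr; rewrite finset.sub1set.
pose D S := f (i |: (S :&: A)) - f (S :&: A).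
have D01 S : 0 <= D S <= 1.
  by rewrite fmarg andbT subr_ge0 fmono// finset.subsetUr.
have /andP[xi0 xi1] := x01 i.
have -> : M (fun S => f (S :&: (i |: A))) =
    M (fun S => f (S :&: A)) + x i * M D.
  rewrite -(multilinear_extension_avg i) avg_restrict//.
  rewrite -multilinear_extensionZ -multilinear_extensionD.
  by congr multilinear_extension; apply/funext => S; rewrite /D; ring.
pose u S := expR (- lam * f (S :&: A)).
pose v S := 1 + (- (a * x i)) * D S.
have Mv : M v = 1 + (- (a * x i)) * M D.
  rewrite multilinear_extensionD multilinear_extension_cst.
  by rewrite multilinear_extensionZ.
have le1 : M (fun S => expR (- lam * f (S :&: (i |: A)))) <=
    M (fun S => u S * v S).
  rewrite -(multilinear_extension_avg i).
  rewrite (@avg_restrict i A (fun S => expR (- lam * f S)))//.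
  apply: multilinear_extension_le => S.
  have -> : expR (- lam * f (i |: S :&: A)) = u S * expR (- lam * D S).
    by rewrite -expRD; congr expR; rewrite /D; ring.
  rewrite -/(u S) /v.
  have := expR_chord lam (D01 S); rewrite -/a => H.
  have := ler_wpM2l (expR_ge0 (- lam * f (S :&: A))) (ler_wpM2l xi0 H).
  rewrite -/(u S); lra.
apply: (le_trans le1).
have le2 : M (fun S => u S * v S) <= M u * M v.
  apply: multilinear_extension_harris => S S' SS'.
    rewrite lerN2 ler_expR !mulNr lerN2 ler_wpM2l// fmono//.
    exact: finset.setSI.
  rewrite /v lerD2l !mulNr lerN2 ler_wpM2l ?mulr_ge0//.
  apply: fsub; first exact: finset.setSI.
  by rewrite inE (negbTE iA) andbF.
apply: (le_trans le2); rewrite mulrDr expRD.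
(* The induction hypothesis bounds [M u], and [1 + y <= expR y] bounds [M v]. The product rule also
   needs both to be nonnegative; for [M v] this holds because [a], [x i] and [D S] are at most 1. *)
apply: ler_pM => //.
- rewrite -(multilinear_extension_cst 0).
  by apply: multilinear_extension_le => S; exact: expR_ge0.
- rewrite -(multilinear_extension_cst 0).
  apply: multilinear_extension_le => S; rewrite /v mulNr subr_ge0.
  have /andP[? ?] := D01 S.
  apply: mulr_ile1 => //; first exact: mulr_ge0.
  by apply: mulr_ile1 => //; rewrite /a lerBlDr lerDl expR_ge0.
- rewrite Mv (_ : - a * (x i * M D) = - (a * x i) * M D); last by ring.
  exact: expR_ge1Dx.
Qed.

(** * Supermodular functions under negative association *)

(** The discrete derivative is defined on every set, whether or not it contains [i], so it can
    itself be averaged or paired with [p]. *)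
Definition supermodular u := forall i,
  set_nondecreasing (fun S => u (i |: S) - u (S :\ i)).

(** The derivative in [i] of [avg i u] vanishes; the derivative in any other [j] commutes with
    averaging in [i], which preserves monotonicity. *)
Lemma avg_supermodular i u : supermodular u -> supermodular (avg i u).
Proof.
move=> hu j.
have [->|ji] := eqVneq j i.
  have E S : avg i u (i |: S) = avg i u (S :\ i).
    by apply: (@avg_seq_agree [:: i] u) => k; rewrite !inE => /negbTE ->.
  by move=> S S' _; rewrite !E !subrr.
have -> : (fun S => avg i u (j |: S) - avg i u (S :\ j)) =
          avg i (fun S => u (j |: S) - u (S :\ j)).
  apply/funext => S; rewrite /avg.
  have -> : (j |: S) :\ i = j |: (S :\ i).
    apply/setP => k; rewrite !inE.
    by have [->|] := eqVneq k j; rewrite // ?ji.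
  have -> : i |: (S :\ j) = (i |: S) :\ j.
    apply/setP => k; rewrite !inE.
    by have [->|] := eqVneq k i; rewrite // eq_sym ji.
  have -> : S :\ j :\ i = S :\ i :\ j by rewrite !finset.setDDl finset.setUC.
  by rewrite (finset.setUCA [set i]%SET); ring.
exact: avg_nondecreasing.
Qed.

Section NegativeAssociation.
Variable p : {set 'I_n} -> R.
Hypothesis p_neg : forall i D, set_nondecreasing D ->
  \sum_S D (S :\ i) * (i \in S)%:R * p S <= (\sum_S D (S :\ i) * p S) * x i.

(* u S = u (S \ i) + [i in S] D (S \ i) with D nondecreasing, so negative
   association allows i to be resampled independently. *)
Lemma sum_supermodular_avg i u : supermodular u ->
  \sum_S u S * p S <= \sum_S avg i u S * p S.
Proof.
move=> hu; pose D S := u (i |: S) - u (S :\ i).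
have DE S : D (S :\ i) = D S.
  rewrite /D; congr (u _ - u _); apply/setP => k; rewrite !inE;
  by case: eqVneq.
have -> : \sum_S u S * p S =
    \sum_S u (S :\ i) * p S + \sum_S D (S :\ i) * (i \in S)%:R * p S.
  rewrite -big_split; apply: eq_bigr => S _ /=.
  rewrite DE -mulrDl; congr (_ * _).
  rewrite /D; case: (boolP (i \in S)) => iS.
    rewrite mulr1 subrKC; congr u.
    by apply/esym/finset.setUidPr; rewrite finset.sub1set.
  rewrite mulr0 addr0; congr u.
  by apply/esym/finset.setDidPl; rewrite disjoint_sym disjoints1.
have -> : \sum_S avg i u S * p S =
    \sum_S u (S :\ i) * p S + (\sum_S D (S :\ i) * p S) * x i.
  rewrite mulr_suml -big_split; apply: eq_bigr => S _ /=.
  by rewrite DE /D /avg; ring.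
by rewrite lerD2l; apply: p_neg; exact: hu.
Qed.

Lemma sum_supermodular_le u : \sum_S p S = 1 -> supermodular u ->
  \sum_S u S * p S <= M u.
Proof.
move=> p1 hu.
have H s : supermodular (avg_seq s u) /\
    \sum_S u S * p S <= \sum_S avg_seq s u S * p S.
  elim: s => [|i s [IHu IH]] //=; split; first exact: avg_supermodular.
  exact: le_trans IH (sum_supermodular_avg i IHu).
have [_] := H (enum 'I_n).
(* The fully averaged function is constantly [M u], and [p] has total mass 1. *)
under [in leRHS]eq_bigr do rewrite -multilinear_extension_avg_seq.
by rewrite -mulr_sumr p1 mulr1.
Qed.

End NegativeAssociation.

End Averaging.

(** Adding [i] decreases the exponential by its value times its relative drop. Along [A \subset B]
    the value shrinks by monotonicity ([b <= a]) and the relative drop by submodularity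
    ([1 - e <= 1 - c]). *)
Lemma expR_submodular_supermodular (R : realType) (n : nat)
    (f : {set 'I_n} -> R) (lam : R) :
  set_nondecreasing f -> submodular f -> 0 <= lam ->
  supermodular (fun S => expR (- lam * f S)).
Proof.
move=> fmono fsub lam0 i S S' SS'; rewrite -subr_ge0.
have iDU (B : {set 'I_n}) : i |: B = i |: (B :\ i).
  by apply/setP => k; rewrite !inE; case: eqVneq.
rewrite (iDU S) (iDU S').
have : S :\ i \subset S' :\ i by exact: finset.setSD.
have : i \notin S' :\ i by rewrite !inE eqxx.
move: (S :\ i) (S' :\ i) => A B iB AB.
have DAB := fsub _ _ _ AB iB.
have fAB := fmono _ _ AB.
have DB : 0 <= f (i |: B) - f B by rewrite subr_ge0 fmono// finset.subsetUr.
have E C : expR (- lam * f (i |: C)) =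
    expR (- lam * f C) * expR (- lam * (f (i |: C) - f C)).
  by rewrite -expRD; congr expR; ring.
rewrite !E.
set a := expR (- lam * f A); set b := expR (- lam * f B).
set c := expR (- lam * (_ - f A)); set e := expR (- lam * (_ - f B)).
have b0 : 0 <= b by exact: expR_ge0.
have ba : b <= a by rewrite ler_expR !mulNr lerN2 ler_wpM2l.
have ce : c <= e by rewrite ler_expR !mulNr lerN2 ler_wpM2l.
have e1 : e <= 1 by rewrite -[leRHS]expR0 ler_expR mulNr oppr_le0 mulr_ge0.
have -> : b * e - b - (a * c - a) = b * (e - c) + (a - b) * (1 - c) by ring.
rewrite addr_ge0// mulr_ge0// subr_ge0//; exact: le_trans e1.
Qed.


(** * The finite law of the random set *)

Section RandomSetLaw.
Context (d : measure_display) (T : measurableType d) (R : realType).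
Variables (P : probability T R) (n : nat) (X : 'I_n -> {RV P >-> bool}).

Let rset w : {set 'I_n} := random_set (fun i => X i) w.

Definition random_set_event (S : {set 'I_n}) : set T :=
  [set w | rset w = S]%classic.

Definition random_set_law (S : {set 'I_n}) : R := fine (P (random_set_event S)).

Lemma measurable_random_set_event S : measurable (random_set_event S).
Proof.
have -> : random_set_event S =
    (\bigcap_(i in [set: 'I_n]) (X i @^-1` [set (i \in S)]))%classic.
  apply/seteqP; split => w /=.
    by move=> <- i _ /=; rewrite /rset inE.
  by move=> H; apply/setP => i; rewrite /rset inE; exact: H.
apply: fin_bigcap_measurable => // i _.
rewrite -[X in measurable X]setTI; exact: measurable_funPT.
Qed.

Lemma random_set_law_ge0 S : 0 <= random_set_law S.
Proof. exact/fine_ge0/measure_ge0. Qed.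

(** A function of the random set is a finite combination of indicators of the events
    [random_set_event S], so its expectation is a finite sum. *)
Lemma expectation_random_set (phi : {set 'I_n} -> R) :
  ('E_P[fun w => phi (rset w)] = (\sum_S phi S * random_set_law S)%:E)%E.
Proof.
have E w : (phi (rset w))%:E =
    (\sum_S ((phi S)%:E * (\1_(random_set_event S) w)%:E))%E.
  rewrite (bigD1 (rset w))//= big1 ?adde0.
    by rewrite indicE mem_set// mule1.
  move=> S /eqP SW; rewrite indicE memNset ?mule0//.
  by move=> /esym.
rewrite unlock; under eq_integral do rewrite E.
rewrite integral_sum//; last first.
  move=> S; apply: integrableZl => //; apply: integrable_indic => //.
  exact: measurable_random_set_event.
rewrite -sumEFin; apply: eq_bigr => S _.
have mS := measurable_random_set_event S.
rewrite integralZl//; last exact: integrable_indic.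
by rewrite integral_indic// setIT EFinM /random_set_law fineK// fin_num_measure.
Qed.

Lemma sum_random_set_law : \sum_S random_set_law S = 1.
Proof.
have := expectation_random_set (fun=> 1); rewrite expectation_cst => -[].
by under eq_bigr do rewrite mul1r.
Qed.

Lemma probability_random_set (Q : pred {set 'I_n}) :
  P [set w | Q (rset w)]%classic = (\sum_S (Q S)%:R * random_set_law S)%:E.
Proof.
rewrite -expectation_random_set -expectation_indic.
  by congr expectation; apply/funext => w; rewrite indicE mem_setE.
have -> : [set w | Q (rset w)]%classic =
    (\bigcup_(S in [set S | Q S]) random_set_event S)%classic.
  apply/seteqP; split => w /=; first by move=> ?; exists (rset w).
  by case=> S /= QS; rewrite /random_set_event /= => ->.
apply: fin_bigcup_measurable; first exact: finite_finset.
by move=> S _; exact: measurable_random_set_event.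
Qed.

Lemma random_set_law_negative (x : 'I_n -> R) :
  (forall i, 'E_P[fun w => (X i w)%:R]%E = (x i)%:E) ->
  one_negatively_associated X ->
  forall i (D : {set 'I_n} -> R), set_nondecreasing D ->
  \sum_S D (S :\ i) * (i \in S)%:R * random_set_law S <=
    (\sum_S D (S :\ i) * random_set_law S) * x i.
Proof.
move=> hx hNA i D hD.
(* A point of the cube without coordinate [i] is read as a subset avoiding [i]; along [X] it gives
   [rset w :\ i]. *)
pose toset (y : {ffun {j : 'I_n | j != i} -> bool}) : {set 'I_n} :=
  [set j | if insub j is Some k then y k else false]%SET.
have totE w : toset (others i (fun j => X j) w) = rset w :\ i.
  apply/setP => j; rewrite !inE; case: insubP => [k ji <-|/negbTE -> //].
  by rewrite ffunE (valP k).
have := hNA i (fun b => b%:R) (D \o toset).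
have -> : (fun w => ((D \o toset) (others i (fun j => X j) w) * (X i w)%:R)%R) =
   (fun w => D (rset w :\ i) * (i \in rset w)%:R).
  by apply/funext => w /=; rewrite totE inE.
have -> : (fun w => (D \o toset) (others i (fun j => X j) w)) =
   (fun w => D (rset w :\ i)).
  by apply/funext => w /=; rewrite totE.
rewrite (expectation_random_set (fun S => D (S :\ i) * (i \in S)%:R)).
rewrite (expectation_random_set (fun S => D (S :\ i))) hx -EFinM lee_fin; apply.
left; split; first by move=> [] [] //= _; rewrite ler01.
move=> y z yz; apply: hD; apply/fintype.subsetP => j; rewrite !inE.
by case: insubP => // k _ _; apply/implyP; exact: yz.
Qed.

(** Makes the product weights built from [x] nonnegative: each mean is a sum of part of a
    probability law. *)
Lemma random_set_mean (x : 'I_n -> R) i :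
  'E_P[fun w => (X i w)%:R]%E = (x i)%:E ->
  0 <= x i <= 1.
Proof.
have -> : (fun w => (X i w)%:R) = (fun w => (i \in rset w)%:R) :> (T -> R).
  by apply/funext => w; rewrite inE.
rewrite (expectation_random_set (fun S => (i \in S)%:R)) => -[<-].
rewrite sumr_ge0 /= => [|S _]; last by rewrite mulr_ge0// random_set_law_ge0.
rewrite -[leRHS]sum_random_set_law; apply: ler_sum => S _.
by rewrite ler_piMl ?random_set_law_ge0// lern1 leq_b1.
Qed.

End RandomSetLaw.

(** * The lower tail bound *)

Theorem theorem2 (d : measure_display) (T : measurableType d) (R : realType)
    (P : probability T R) (n : nat) (X : 'I_n -> {RV P >-> bool})
    (x : 'I_n -> R) (f : {set 'I_n} -> R) (delta : R)
    (hmean : forall i : 'I_n, 'E_P[fun w => (X i w)%:R]%E = (x i)%:E)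
    (hNA : one_negatively_associated X)
    (hf0 : forall S : {set 'I_n}, 0 <= f S)
    (hfmono : set_nondecreasing f)
    (hfsub : submodular f)
    (hfmarg : forall (S : {set 'I_n}) (i : 'I_n), 0 <= f (i |: S) - f S <= 1)
    (hdelta : 0 < delta < 1) :
  let mu0 := multilinear_extension f x in
  (P [set w | (f (random_set X w) <= (1 - delta) * mu0)%R]%classic
    <= (expR (- (mu0 * delta ^+ 2 / 2)))%:E)%E.
Proof.
cbv zeta; set mu0 := multilinear_extension f x; case/andP: hdelta => d0 d1.
have x01 i : 0 <= x i <= 1 by exact: random_set_mean (hmean i).
have mu_ge0 : 0 <= mu0.
  by rewrite -(multilinear_extension_cst x 0); exact: multilinear_extension_le.
rewrite (probability_random_set X (fun S => f S <= (1 - delta) * mu0)) lee_fin.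
set p := random_set_law X; set c := (1 - delta) * mu0.
(* Exponential Markov with parameter [delta]: the indicator of [f S <= c] is at most
   [expR (delta * (c - f S))]. *)
have markov : \sum_S (f S <= c)%R%:R * p S <=
    expR (delta * c) * \sum_S expR (- delta * f S) * p S.
  rewrite mulr_sumr; apply: ler_sum => S _; rewrite mulrA.
  rewrite ler_wpM2r ?random_set_law_ge0// -expRD mulNr -mulrBr.
  case: (leP (f S) c) => fSc; last exact: expR_ge0.
  by rewrite -[leLHS]expR0 ler_expR mulr_ge0 ?subr_ge0// ltW.
apply: (le_trans markov).
have na : \sum_S expR (- delta * f S) * p S <=
    multilinear_extension (fun S => expR (- delta * f S)) x.
  apply: sum_supermodular_le => //.
  - exact: random_set_law_negative.
  - exact: sum_random_set_law.
  - by apply: expR_submodular_supermodular => //; exact: ltW.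
have mgf := multilinear_extension_mgf x01 (hf0 finset.set0) hfmono hfsub
  (fun S i => proj2 (andP (hfmarg S i))) (ltW d0).
apply: (le_trans (ler_wpM2l (expR_ge0 _) (le_trans na mgf))).
rewrite -expRD ler_expR -/mu0 /c.
(* The exponent is [mu0] times [delta * (1 - delta) - 1 + expR (- delta)], and the Taylor bound
   makes this factor at most [- delta ^+ 2 / 2]. *)
have := ler_wpM2l mu_ge0 (expRN_le_taylor2 (ltW d0)); lra.
Qed.
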